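(* Let $\rho>0$, let $T\in\mathrm{Lip}(\rho)$, $T:C\to C$, and assume there exists $x^*\in C$ with $x^*=Tx^*$. Let $x^0\in C$ and $\delta_0\ge\|x^0-x^*\|$. Set $R_0^{\flat}=1+\rho$ and, for $n\ge1$, $$\beta_n^{\flat}=B_\rho^{\flat}(R_{n-1}^{\flat}),\qquad R_n^{\flat}=V_\rho^{\flat}(R_{n-1}^{\flat}),\qquad x^n=(1-\beta_n^{\flat})x^0+\beta_n^{\flat}\,Tx^{n-1}.$$ Then for all $n\ge1$ we have $\|x^n-Tx^n\|\le\delta_0R_n^{\flat}$. Moreover the sequence $(R_n^{\flat})$ is monotonically non-increasing and converges to $r_\rho^{\flat}$, and the sequence $(\beta_n^{\flat})$ is monotonically non-decreasing and converges to $\beta_\rho^{\flat}$, where $$r_\rho^{\flat}=\begin{cases}0&\text{if }\rho<1\\(\sqrt2+1)^2(1-1/\rho)&\text{if }\rho\in[1,\sqrt2+1]\\1+\rho&\text{if }\rho>\sqrt2+1\end{cases}\qquad \beta_\rho^{\flat}=\begin{cases}1&\text{if }\rho<1\\(\sqrt2+1-\rho)/(\rho\sqrt2)&\text{if }\rho\in[1,\sqrt2+1]\\0&\text{if }\rho>\sqrt2+1.\end{cases}$$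
   Context: For $\rho>0$, $\mathrm{Lip}(\rho)$ is the class of all maps $T:C\to C$, where $C$ is a nonempty convex subset (not necessarily bounded or closed) of an arbitrary real normed space $(X,\|\cdot\|)$ (not necessarily complete), such that $\|Tx-Ty\|\le\rho\|x-y\|$ for all $x,y\in C$. For $r\ge0$ define $$V_\rho^{\flat}(r)=\min_{\beta\in[0,1]}\;(1+\rho)-(1+3\rho)\beta+2\rho\beta^2+\rho\beta r,$$ whose minimizer over $[0,1]$ is $$B_\rho^{\flat}(r)=\begin{cases}1&\text{if }r\le1/\rho-1\\ (1/\rho+3-r)/4&\text{if }r\in[1/\rho-1,1/\rho+3]\\0&\text{if }r\ge1/\rho+3.\end{cases}$$ *)

(* Defs.v *)
From HB Require Import structures.
From mathcomp Require Import all_boot all_order all_algebra.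
From mathcomp Require Import all_classical all_reals all_analysis.
From mathcomp Require Import ring lra.

Set Implicit Arguments.
Unset Strict Implicit.
Unset Printing Implicit Defensive.

Import Order.TTheory GRing.Theory Num.Theory.
Import numFieldNormedType.Exports.

Local Open Scope classical_set_scope.
Local Open Scope ring_scope.

(* A map T : C -> C is given by a total function on X; its values outside C
   are irrelevant. *)
Definition Lip (R : realType) (X : normedModType R) (rho : R)
    (C : set X) (T : X -> X) : Prop :=
  [/\ C !=set0, convex_set C, set_fun C C T & rho.-lipschitz_C T].

Section Flat.
Variables (R : realType) (rho : R).
Implicit Types (r b : R) (n : nat).

Definition objflat r b : R :=
  (1 + rho) - (1 + 3 * rho) * b + 2 * rho * b ^+ 2 + rho * b * r.

(* The infimum is attained for 0 < rho, see Vflat_min below. *)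
Definition Vflat r : R := inf (objflat r @` `[0, 1]).

(* The overlapping cases agree at r = 1 / rho - 1 and r = 1 / rho + 3. *)
Definition Bflat r : R :=
  if r <= 1 / rho - 1 then 1
  else if r <= 1 / rho + 3 then (1 / rho + 3 - r) / 4
  else 0.

Fixpoint Rflat n : R :=
  if n is m.+1 then Vflat (Rflat m) else 1 + rho.

(* Only meaningful for n >= 1; betaflat 0 is a dummy value. *)
Definition betaflat n : R := Bflat (Rflat n.-1).

Definition rlim : R :=
  if rho < 1 then 0
  else if rho <= Num.sqrt 2 + 1 then (Num.sqrt 2 + 1) ^+ 2 * (1 - 1 / rho)
  else 1 + rho.

Definition betalim : R :=
  if rho < 1 then 1
  else if rho <= Num.sqrt 2 + 1 then
    (Num.sqrt 2 + 1 - rho) / (rho * Num.sqrt 2)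
  else 0.

Hypothesis rho_gt0 : 0 < rho.

Lemma Bflat_itv r : Bflat r \in `[0, 1].
Proof.
rewrite /Bflat in_itv /=; have [h1|h1] := leP r (1 / rho - 1); first by lra.
by have [h2|h2] := leP r (1 / rho + 3); lra.
Qed.

Lemma objflat_Bflat_le r b : b \in `[0, 1] ->
  objflat r (Bflat r) <= objflat r b.
Proof.
rewrite in_itv /= => /andP[b0 b1]; rewrite /objflat /Bflat.
set s := 1 / rho; have rs : rho * s = 1 by rewrite /s mulrC divfK ?gt_eqF.
have rho_ge0 := ltW rho_gt0; rewrite -subr_ge0.
have sq x : 0 <= 2 * rho * x ^+ 2.
  by apply: mulr_ge0; [exact: mulr_ge0 | exact: sqr_ge0].
have [h1|h1] := leP r (s - 1).
  rewrite [leRHS](_ : _ = rho * ((1 - b) * (s - 1 - r))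
    + 2 * rho * (1 - b) ^+ 2 + (1 - rho * s) * (1 - b)); last by ring.
  rewrite rs subrr mul0r addr0.
  by rewrite addr_ge0 // mulr_ge0 // mulr_ge0 // subr_ge0.
have [h2|h2] := leP r (s + 3).
  set c := (s + 3 - r) / 4; have rE : r = s + 3 - 4 * c by rewrite /c; field.
  rewrite [leRHS](_ : _ = 2 * rho * (b - c) ^+ 2 + (1 - rho * s) * (c - b));
    last by rewrite rE; ring.
  by rewrite rs subrr mul0r addr0.
rewrite [leRHS](_ : _ = rho * (b * (r - (s + 3)))
  + 2 * rho * b ^+ 2 - (1 - rho * s) * b); last by ring.
rewrite rs subrr mul0r subr0.
by rewrite addr_ge0 // mulr_ge0 // mulr_ge0 // subr_ge0 ltW.
Qed.

Lemma Vflat_min r : Vflat r = objflat r (Bflat r).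
Proof.
have lbB : lbound (objflat r @` `[0, 1]) (objflat r (Bflat r)).
  by move=> _ [b bI <-]; exact: objflat_Bflat_le.
have Bin : (objflat r @` `[0, 1]) (objflat r (Bflat r)).
  by exists (Bflat r) => //; exact: Bflat_itv.
apply/eqP; rewrite eq_le; apply/andP; split.
  by apply: ge_inf => //; exists (objflat r (Bflat r)).
by apply: lb_le_inf => //; exists (objflat r (Bflat r)).
Qed.

End Flat.

Fixpoint halpern (R : realType) (X : lmodType R) (T : X -> X) (beta : nat -> R)
    (x0 : X) (n : nat) : X :=
  if n is m.+1 then
    (1 - beta m.+1) *: x0 + beta m.+1 *: T (halpern T beta x0 m)
  else x0.

(* Main.v *)
(* Writing a_n = 1 + rho * d_n for the bound on |x0 - T x^n| / delta0, where
   d_n bounds |x^n - x*| / delta0, and c_n for the one on |T x^n - T x^(n-1)|,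
   the residual is at most (1 - beta_n) a_n + beta_n c_n; the d_n cancel and
   this is the recursion for R_n, for arbitrary nondecreasing beta.  For the
   limit, rlim is a lower bound because it lies below its own objective on
   [0, 1], and any limit l satisfies l <= objflat l b for every b, which for a
   suitable b (mostly betalim) forces l <= rlim. *)
Require Import Defs.
From HB Require Import structures.
From mathcomp Require Import all_boot all_order all_algebra.
From mathcomp Require Import all_classical all_reals all_analysis.
From mathcomp Require Import ring lra.

Set Implicit Arguments.
Unset Strict Implicit.
Unset Printing Implicit Defensive.

Import Order.TTheory GRing.Theory Num.Theory.
Import numFieldNormedType.Exports.

Local Open Scope classical_set_scope.
Local Open Scope ring_scope.

(** * Residual bounds for Halpern iterates *)

Section HalpernResidual.
Variables (R : realType) (X : normedModType R) (rho : R) (C : set X).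
Variables (T : X -> X) (xstar x0 : X) (delta0 : R).
Hypotheses (rho_gt0 : 0 < rho) (LipT : Lip rho C T).
Hypotheses (Cxstar : C xstar) (fixT : xstar = T xstar).
Hypotheses (Cx0 : C x0) (hdelta0 : `|x0 - xstar| <= delta0).
Variables beta r : nat -> R.
Hypothesis beta01 : forall n, 0 <= beta n <= 1.
Hypothesis beta_nd : forall n, beta n.+1 <= beta n.+2.
Hypothesis r0 : r 0%N = 1 + rho.
Hypothesis rS : forall n, r n.+1 = objflat rho (r n) (beta n.+1).

Local Notation x := (halpern T beta x0).

Let lipT y z : C y -> C z -> `|T y - T z| <= rho * `|y - z|.
Proof. by case: LipT => _ _ _ lip Cy Cz; exact: (lip (y, z)). Qed.

Let CT y : C y -> C (T y).
Proof. by case: LipT => _ _ CT _; exact: CT. Qed.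

Let halpernS n : x n.+1 = x0 + beta n.+1 *: (T (x n) - x0).
Proof. by rewrite /= scalerBl scale1r scalerBr addrAC -addrA. Qed.

Lemma halpern_in n : C (x n).
Proof.
elim: n => //= n Cxn; case: LipT => _ cvxC _ _.
have /andP[b0 b1] := beta01 n.+1; have := cvxC (T (x n)) x0 (Itv01 b0 b1).
by rewrite !inE addrC => /(_ (CT Cxn) Cx0).
Qed.

Fixpoint dstar n : R :=
  if n is m.+1 then (1 - beta m.+1) + beta m.+1 * (rho * dstar m) else 1.

Lemma halpern_dist_fixpoint n : `|x n - xstar| <= delta0 * dstar n.
Proof.
elim: n => [|n IHn]; first by rewrite mulr1.
have /andP[b0 b1] := beta01 n.+1.
(* [xstar] is split with the same weights as [x n.+1]. *)
rewrite /= -[xstar](subrK (beta n.+1 *: xstar)) -{1}(scale1r xstar).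
rewrite -scalerBl opprD addrACA -!scalerBr (le_trans (ler_normD _ _))//.
rewrite !normrZ !ger0_norm ?subr_ge0// mulrDr lerD//.
  by rewrite mulrC ler_wpM2r// subr_ge0.
rewrite mulrCA ler_wpM2l// {1}fixT (le_trans (lipT (halpern_in n) Cxstar))//.
by rewrite mulrCA ler_wpM2l// ltW.
Qed.

Let halpern_dist_start n : `|x0 - T (x n)| <= delta0 * (1 + rho * dstar n).
Proof.
rewrite -(subrKA xstar) (le_trans (ler_normD _ _))// mulrDr mulr1 lerD//.
rewrite {1}fixT (le_trans (lipT Cxstar (halpern_in n)))//.
by rewrite mulrCA ler_wpM2l ?(ltW rho_gt0)// distrC halpern_dist_fixpoint.
Qed.

(* As [beta] is nondecreasing, [x n.+2] arises from [x n.+1] by replacing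
   [T (x n)] with [T (x n.+1)] and moving mass only from [x0] to the latter. *)
Lemma halpern_step n :
  `|x n.+1 - x n| <= delta0 * (r n - (1 - beta n.+1) * (1 + rho * dstar n)).
Proof.
elim: n => [|n IHn].
  have /andP[b0 b1] := beta01 1.
  rewrite halpernS addrAC subrr add0r normrZ ger0_norm// distrC r0.
  apply: le_trans (ler_wpM2l b0 (halpern_dist_start 0)) _.
  by rewrite le_eqVlt; apply/orP; left; apply/eqP => /=; ring.
have /andP[b0 b1] := beta01 n.+1; have b12 := beta_nd n.
rewrite halpernS [X in _ - X]halpernS opprD addrACA subrr add0r.
set p := T (x n.+1) - x0; set q := T (x n) - x0.
have -> : beta n.+2 *: p - beta n.+1 *: q =
    (beta n.+2 - beta n.+1) *: p + beta n.+1 *: (T (x n.+1) - T (x n)).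
  have -> : T (x n.+1) - T (x n) = p - q by rewrite /p /q opprB subrKA.
  by rewrite scalerBl (scalerBr _ p q) subrKA.
rewrite (le_trans (ler_normD _ _))// !normrZ !ger0_norm ?subr_ge0//.
have h1 : `|p| <= delta0 * (1 + rho * dstar n.+1) by rewrite distrC.
have := lipT (halpern_in n.+1) (halpern_in n).
move=> /le_trans/(_ (ler_wpM2l (ltW rho_gt0) IHn)) h2.
have h1' : 0 <= beta n.+2 - beta n.+1 by rewrite subr_ge0.
apply: le_trans (lerD (ler_wpM2l h1' h1) (ler_wpM2l b0 h2)) _.
(* An equality: [dstar n] cancels once [dstar n.+1] is unfolded, and [beta n.+2] enters only through
   the weight of the bound on [|p|]. *)
by rewrite le_eqVlt rS /objflat; apply/orP; left; apply/eqP => /=; ring.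
Qed.

Lemma halpern_residual n : `|x n.+1 - T (x n.+1)| <= delta0 * r n.+1.
Proof.
have /andP[b0 b1] := beta01 n.+1.
set y := T (x n.+1).
have -> : x n.+1 - y =
    (1 - beta n.+1) *: (x0 - y) + beta n.+1 *: (T (x n) - y).
  by rewrite !scalerBr addrACA -opprD -scalerDl subrK scale1r.
rewrite (le_trans (ler_normD _ _))// !normrZ !ger0_norm ?subr_ge0//.
have := lipT (halpern_in n) (halpern_in n.+1).
rewrite [`|x n - _|]distrC.
move=> /le_trans/(_ (ler_wpM2l (ltW rho_gt0) (halpern_step n))) h2.
have b1' : 0 <= 1 - beta n.+1 by rewrite subr_ge0.
have h1 := ler_wpM2l b1' (halpern_dist_start n.+1).
apply: le_trans (lerD h1 (ler_wpM2l b0 h2)) _.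
by rewrite le_eqVlt rS /objflat; apply/orP; left; apply/eqP => /=; ring.
Qed.

End HalpernResidual.

(** * Monotonicity of the scalar recursion *)

Section FlatRecursion.
Variables (R : realType) (rho : R).
Hypothesis rho_gt0 : 0 < rho.
Implicit Types (r b : R) (n : nat).

Let s := 1 / rho.
Let rho_s : rho * s = 1. Proof. by rewrite /s mulrC divfK ?gt_eqF. Qed.

Lemma objflat_nd b r r' :
  0 <= b -> r <= r' -> objflat rho r b <= objflat rho r' b.
Proof.
by move=> b0 rr'; rewrite lerD2l ler_wpM2l// mulr_ge0// ltW.
Qed.

Lemma Vflat_le r b : 0 <= b <= 1 -> Vflat rho r <= objflat rho r b.
Proof. by move=> b01; rewrite Vflat_min// objflat_Bflat_le// in_itv. Qed.

(** The minimizer for [r'] is a competitor for [r]. *)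
Lemma Vflat_nd r r' : r <= r' -> Vflat rho r <= Vflat rho r'.
Proof.
move=> rr'; rewrite [leRHS]Vflat_min//.
have := Bflat_itv rho r'; rewrite in_itv/= => B01.
apply: le_trans (Vflat_le r B01) _.
by case/andP: B01 => B0 _; exact: objflat_nd.
Qed.

Lemma Rflat_ni : nonincreasing_seq (Rflat rho).
Proof.
apply/nonincreasing_seqP; elim=> [|n IHn] /=; last exact: Vflat_nd.
(* At [b = 0] the objective is [1 + rho], whatever [r] is. *)
have := @Vflat_le (1 + rho) 0; rewrite lexx ler01 => /(_ isT)/le_trans; apply.
by rewrite /objflat; lra.
Qed.

Lemma Bflat_ni r r' : r <= r' -> Bflat rho r' <= Bflat rho r.
Proof.
by rewrite /Bflat -/s => rr'; case: (leP r (s - 1)); case: (leP r' (s - 1));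
  case: (leP r (s + 3)); case: (leP r' (s + 3)); lra.
Qed.

(** [Bflat] clips to [[0, 1]] an affine function of slope [-1/4]; this bound supplies the continuity
    used for the limit of [betaflat]. *)
Lemma Bflat_sub_le r r' :
  r <= r' -> Bflat rho r - Bflat rho r' <= (r' - r) / 4.
Proof.
by rewrite /Bflat -/s => rr'; case: (leP r (s - 1)); case: (leP r' (s - 1));
  case: (leP r (s + 3)); case: (leP r' (s + 3)); lra.
Qed.

Lemma betaflat_nd m n : (m <= n)%N -> betaflat rho m <= betaflat rho n.
Proof.
by move=> mn; apply: Bflat_ni; apply: Rflat_ni; rewrite -!subn1 leq_sub2r.
Qed.

(** * The candidate limits *)

Lemma betalim_itv : 0 <= betalim rho <= 1.
Proof.
rewrite /betalim; case: (ltP rho 1) => [_|rho1]; first by rewrite ?ler01 ?lexx.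
case: (leP rho) => [rho2|_]; last by rewrite ?lexx ?ler01.
have t0 : 0 < Num.sqrt (2 : R) by rewrite sqrtr_gt0.
have p0 : 0 < rho * Num.sqrt 2 by rewrite mulr_gt0.
rewrite divr_ge0 ?subr_ge0 ?(ltW p0)//= ler_pdivrMr// mul1r.
have : 0 <= (rho - 1) * (Num.sqrt 2 + 1).
  by rewrite mulr_ge0 ?subr_ge0 ?addr_ge0 ?ler01 ?sqrtr_ge0.
by lra.
Qed.

Let t : R := Num.sqrt 2.
Let t_gt0 : 0 < t. Proof. by rewrite sqrtr_gt0. Qed.
Let t_sqr : t ^+ 2 = 2. Proof. by rewrite sqr_sqrtr. Qed.

(** Polynomial in [s] and [t], so that identities reduce to [rho * s = 1] and [t ^+ 2 = 2]. *)
Let betalimE : 1 <= rho <= t + 1 -> betalim rho = s * (1 + t / 2) - t / 2.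
Proof.
rewrite /betalim -/t => /andP[rho1 rho2]; rewrite ltNge rho1 rho2/=.
have p0 : rho * t != 0 by rewrite mulf_neq0 ?gt_eqF.
apply: (mulIf p0); rewrite divfK//.
by field: rho_s t_sqr.
Qed.

Let rlimE : 1 <= rho <= t + 1 -> rlim rho = (3 + 2 * t) * (1 - s).
Proof.
rewrite /rlim -/t -/s => /andP[rho1 rho2]; rewrite ltNge rho1 rho2/=.
by ring: t_sqr.
Qed.

Let s_le1 : 1 <= rho -> s <= 1.
Proof. by move=> rho1; rewrite -rho_s ler_peMl// /s divr_ge0// ltW. Qed.

Let rho_quad_ge0 : t + 1 < rho -> 0 <= rho ^+ 2 - 2 * rho - 1.
Proof.
move=> h; have : 0 <= (rho - 1 - t) * (rho - 1 + t).
  by rewrite mulr_ge0//; have := t_gt0; lra.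
by rewrite -subr_sqr t_sqr; lra.
Qed.

(* The objective at [rlim] touches the value [rlim] at its minimizer. *)
Let objflat_rlim b : 1 <= rho <= t + 1 ->
  objflat rho (rlim rho) b - rlim rho = 2 * rho * (b - betalim rho) ^+ 2.
Proof.
by move=> rho12; rewrite rlimE// betalimE// /objflat; field: rho_s t_sqr.
Qed.

Lemma rlim_le_objflat b :
  0 <= b <= 1 -> rlim rho <= objflat rho (rlim rho) b.
Proof.
move=> /andP[b0 b1]; rewrite -subr_ge0.
have rho0 := ltW rho_gt0; have [rho1|rho1] := ltP rho 1.
  rewrite /rlim rho1 /objflat.
  rewrite [leRHS](_ : _ = (1 - b) * ((1 - rho) + 2 * rho * (1 - b)));
    last by ring.
  apply: mulr_ge0; first by rewrite subr_ge0.
  by apply: addr_ge0; rewrite ?mulr_ge0 ?subr_ge0// ltW.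
have [rho2|rho2] := leP rho (t + 1).
  by rewrite objflat_rlim ?rho1// mulr_ge0 ?sqr_ge0// mulr_ge0.
rewrite /rlim ltNge rho1 [rho <= _]leNgt -/t rho2 /= /objflat.
rewrite [leRHS](_ : _ = b * ((rho ^+ 2 - 2 * rho - 1) + 2 * rho * b));
  last by ring.
by rewrite mulr_ge0// addr_ge0 ?rho_quad_ge0// !mulr_ge0.
Qed.

Lemma rlim_le_Rflat n : rlim rho <= Rflat rho n.
Proof.
elim: n => [|n IHn] /=.
  have := @rlim_le_objflat 0; rewrite lexx ler01 => /(_ isT).
  by rewrite /objflat; lra.
have := Bflat_itv rho (Rflat rho n); rewrite in_itv/= => B01.
rewrite Vflat_min//; apply: le_trans (rlim_le_objflat B01) _.
by apply: objflat_nd => //; case/andP: B01.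
Qed.

Lemma le_rlim_objflat l : l <= 1 + rho ->
  (forall b, 0 <= b <= 1 -> l <= objflat rho l b) -> l <= rlim rho.
Proof.
move=> l_le H; have [rho1|rho1] := ltP rho 1.
  (* The objective at [b = 1] is [rho * l], so [(1 - rho) * l <= 0]. *)
  have := H 1; rewrite ler01 lexx => /(_ isT).
  rewrite /rlim rho1 /objflat => h.
  by rewrite -(@pmulr_rle0 _ (1 - rho)) ?subr_gt0//; lra.
have [rho2|rho2] := leP rho (t + 1); last first.
  by rewrite /rlim ltNge rho1 [rho <= _]leNgt -/t rho2.
have rho12 : 1 <= rho <= t + 1 by rewrite rho1.
move: (rho1); rewrite le_eqVlt => /predU1P[/esym rhoE|rho1'].
  (* [betalim = 1] yields only [l <= l]; [1 - l / 4] is informative *)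
  have -> : rlim rho = 0.
    have s1 : s = 1 by move: rho_s; rewrite rhoE mul1r.
    by rewrite rlimE// s1 subrr mulr0.
  rewrite leNgt; apply/negP => l0.
  have : 0 <= 1 - l / 4 <= 1 by move: l_le; rewrite rhoE; lra.
  (* This point is the minimizer for [l], with value [l - l ^+ 2 / 8]. *)
  move=> /H; rewrite rhoE /objflat.
  have : 0 < l ^+ 2 by rewrite exprn_gt0.
  by lra.
have /H := betalim_itv; have := objflat_rlim (betalim rho) rho12.
rewrite subrr expr0n mulr0 => e.
(* The objective is affine in [l]; since its slope [rho * betalim rho] is below 1 for [rho > 1], it
   falls below [l] once [l > rlim rho]. *)
have -> : objflat rho l (betalim rho) = rlim rho +
    rho * betalim rho * (l - rlim rho) by move: e; rewrite /objflat; lra.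
have pE : 1 - rho * betalim rho = (rho - 1) * (t / 2).
  by rewrite betalimE//; field: rho_s.
have p0 : 0 < 1 - rho * betalim rho.
  by rewrite pE mulr_gt0 ?subr_gt0// divr_gt0.
by move=> h; rewrite -subr_le0 -(pmulr_rle0 _ p0); lra.
Qed.

(** * Convergence of both sequences *)

Lemma cvg_Rflat : Rflat rho n @[n --> \oo] --> rlim rho.
Proof.
have Rcvg : cvgn (Rflat rho).
  apply: nonincreasing_is_cvgn; first exact: Rflat_ni.
  by exists (rlim rho) => _ [n _ <-]; exact: rlim_le_Rflat.
suff <- : limn (Rflat rho) = rlim rho by [].
have limR n : limn (Rflat rho) <= Rflat rho n.
  exact: nonincreasing_cvgn_ge Rflat_ni Rcvg n.
apply/eqP; rewrite eq_le; apply/andP; split; last first.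
  by apply: limr_ge => //; apply: nearW; exact: rlim_le_Rflat.
apply: le_rlim_objflat => [|b b01]; first exact: limR 0.
(* For fixed [b] the objective is continuous in [r], so the limit passes through the inequality
   without continuity of [Vflat]. *)
have objR : objflat rho (Rflat rho n) b @[n --> \oo] -->
    objflat rho (limn (Rflat rho)) b.
  by apply: cvgD; [|apply: cvgM]; [exact: cvg_cst| exact: cvg_cst| exact: Rcvg].
apply: (cvgr_to_ge objR).
by apply: nearW => n; apply: le_trans (limR n.+1) _; exact: Vflat_le.
Qed.

Lemma Bflat_rlim : Bflat rho (rlim rho) = betalim rho.
Proof.
have [rho1|rho1] := ltP rho 1.
  rewrite /Bflat /betalim /rlim rho1 -/s subr_ge0.
  by rewrite ltW// -rho_s gtr_pMl// divr_gt0.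
have := s_le1 rho1; have [rho2|rho2] := leP rho (t + 1).
  have rho12 : 1 <= rho <= t + 1 by rewrite rho1.
  have := betalim_itv; rewrite betalimE// rlimE// /Bflat -/s => c01 s1.
  (* The middle branch of [Bflat] gives [betalim rho], already in [[0, 1]], so clipping does not
     change it. *)
  have e : s + 3 - (3 + 2 * t) * (1 - s) = 4 * (s * (1 + t / 2) - t / 2).
    by field.
  have : 0 <= (1 - s) * (t + 1) by rewrite mulr_ge0 ?subr_ge0// addr_ge0// ltW.
  by case: (leP _ (s - 1)); [|case: (leP _ (s + 3))]; lra.
move=> s1; rewrite /rlim /betalim ltNge rho1 [rho <= _]leNgt -/t rho2 /= /Bflat -/s.
(* Amounts to [s + 3 <= 1 + rho], the regime where [Bflat] vanishes. *)
have : 0 <= s * (rho ^+ 2 - 2 * rho - 1).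
  by rewrite mulr_ge0 ?rho_quad_ge0// divr_ge0 ?ltW.
have -> : s * (rho ^+ 2 - 2 * rho - 1) = rho - 2 - s by ring: rho_s.
by case: (leP _ (s - 1)); [|case: (leP _ (s + 3))]; lra.
Qed.

Lemma cvg_betaflat : betaflat rho n @[n --> \oo] --> betalim rho.
Proof.
(* After the shift the sequence is [Bflat rho (Rflat rho n)], squeezed by monotonicity and the slope
   bound. *)
rewrite -Bflat_rlim -(cvg_shiftS (betaflat rho)) /betaflat/=.
apply: (@squeeze_cvgr _ _ _ _
    (fun n => Bflat rho (rlim rho) - (Rflat rho n - rlim rho) / 4)
    (fun=> Bflat rho (rlim rho))); last exact: cvg_cst.
  apply: nearW => n; rewrite Bflat_ni ?rlim_le_Rflat// andbT.
  by have := Bflat_sub_le (rlim_le_Rflat n); lra.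
rewrite -[X in _ --> X]subr0 -(mul0r 4^-1) -(subrr (rlim rho)).
apply: cvgB; first exact: cvg_cst.
by apply: cvgM; [apply: cvgB; [exact: cvg_Rflat | exact: cvg_cst] | exact: cvg_cst].
Qed.

End FlatRecursion.

Theorem theorem7 (R : realType) (X : normedModType R) (rho : R)
    (C : set X) (T : X -> X) (xstar x0 : X) (delta0 : R)
    (rho_gt0 : 0 < rho) (LipT : Lip rho C T)
    (Cxstar : C xstar) (fixT : xstar = T xstar)
    (Cx0 : C x0) (hdelta0 : `|x0 - xstar| <= delta0) :
  let x := halpern T (betaflat rho) x0 in
  [/\ forall n : nat, (1 <= n)%N -> `|x n - T (x n)| <= delta0 * Rflat rho n,
      nonincreasing_seq (Rflat rho),
      Rflat rho n @[n --> \oo] --> rlim rho,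
      {in [pred n : nat | (1 <= n)%N] &,
        {homo betaflat rho : m n / (m <= n)%N >-> m <= n}} &
      betaflat rho n @[n --> \oo] --> betalim rho].
Proof.
move=> x; split.
- case=> // n _; apply: (@halpern_residual _ _ rho C _ xstar) => //.
  (* Index 0 is included: the dummy [betaflat rho 0] is also a value of [Bflat]. *)
  + by move=> m; have := Bflat_itv rho (Rflat rho m.-1); rewrite in_itv.
  + by move=> m; exact: betaflat_nd.
  + by move=> m; exact: Vflat_min.
- exact: Rflat_ni.
- exact: cvg_Rflat.
- by move=> m n _ _; exact: betaflat_nd.
- exact: cvg_betaflat.
Qed.
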